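(* Let $A_1,A_2$ be two nonempty $C$-coconvex sets. For $p\in(0,1)$ and $\alpha_1,\alpha_2\ge 0$ (not both zero), the set $\alpha_1\circ A_1\oplus_p\alpha_2\circ A_2$ is a nonempty $C$-coconvex set, whose support function satisfies, for all $x\in\mathrm{int}\,C^\circ$, $$\overline h(\alpha_1\circ A_1\oplus_p\alpha_2\circ A_2,x)=\big(\alpha_1\overline h(A_1,x)^p+\alpha_2\overline h(A_2,x)^p\big)^{\frac1p}.$$
   Context: $C\subset\mathbb{R}^n$ is a fixed pointed closed convex cone with vertex at the origin $o$ and nonempty interior (closed, convex, $\lambda x\in C$ for $x\in C$, $\lambda\ge 0$, and $C\cap(-C)=\{o\}$). Its polar cone is $C^\circ=\{x\in\mathbb{R}^n: x\cdot y\le 0\ \text{for all } y\in C\}$, and $\Omega_C=S^{n-1}\cap\mathrm{int}\,C^\circ$. $V_n$ is volume (Lebesgue measure). For $u\in S^{n-1}$, $t\in\mathbb{R}$, $H^-(u,t)=\{x\in\mathbb{R}^n: x\cdot u\le t\}$. A set $A\subset C$ is $C$-coconvex if $V_n(A)<\infty$ and $A^\bullet=C\setminus A$ is closed and convex. The support function of a $C$-coconvex set $A$ is $\overline h(A,x)=-\sup\{x\cdot y: y\in A^\bullet\}$ for $x\in\mathrm{int}\,C^\circ$; it is positive and finite when $A\ne\emptyset$. For $p\in(0,1)$, $\alpha_1,\alpha_2\ge0$ not both zero, and nonempty $C$-coconvex sets $A_1,A_2$, put $\overline h_*(x)=(\alpha_1\overline h(A_1,x)^p+\alpha_2\overline h(A_2,x)^p)^{1/p}$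 for $x\in\mathrm{int}\,C^\circ$ and define $$\alpha_1\circ A_1\oplus_p\alpha_2\circ A_2=C\setminus\Big(C\cap\bigcap_{u\in\Omega_C}H^-\big(u,-\overline h_*(u)\big)\Big).$$ *)

(* Defs.v *)
From HB Require Import structures.
From mathcomp Require Import all_boot all_order all_algebra.
From mathcomp Require Import all_classical all_reals all_analysis.

Set Implicit Arguments.
Unset Strict Implicit.
Unset Printing Implicit Defensive.

Import Order.TTheory GRing.Theory Num.Theory.
Import numFieldNormedType.Exports.

Local Open Scope classical_set_scope.
Local Open Scope ring_scope.

Section Defs.
Variables (R : realType) (n : nat).
Implicit Types (x y u : 'rV[R]_n) (A B C : set 'rV[R]_n).

Definition dot x y : R := \sum_(i < n) x 0 i * y 0 i.

Definition box (a b : 'rV[R]_n) : set 'rV[R]_n :=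
  [set x | forall i, a 0 i <= x 0 i <= b 0 i].

(* Lebesgue outer measure: infimum of the total volume of countable covers by
   boxes. It is defined on every subset and is Lebesgue measure on measurable
   ones. It is only used below for differences of two closed sets, which are
   Borel. *)
Definition volume A : \bar R :=
  ereal_inf [set s : \bar R | exists a b : nat -> 'rV[R]_n,
    [/\ forall k i, a k 0 i <= b k 0 i,
        A `<=` \bigcup_k box (a k) (b k) &
        s = (\sum_(0 <= k <oo) (\prod_(i < n) (b k 0 i - a k 0 i))%:E)%E]].

Definition pointed_cone C : Prop :=
  [/\ closed C,
      convex_set (C : set (convex_lmodType 'rV[R]_n)),
      forall x (l : R), C x -> 0 <= l -> C (l *: x),
      C `&` [set - x | x in C] = [set 0] &
      interior C !=set0].

Definition polar C : set 'rV[R]_n := [set x | forall y, C y -> dot x y <= 0].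

Definition sphere : set 'rV[R]_n := [set u | dot u u = 1].

Definition Omega C : set 'rV[R]_n := sphere `&` interior (polar C).

Definition halfspace u (t : R) : set 'rV[R]_n := [set x | dot x u <= t].

Definition coconvex C A : Prop :=
  [/\ A `<=` C,
      (volume A < +oo)%E,
      closed (C `\` A) &
      convex_set (C `\` A : set (convex_lmodType 'rV[R]_n))].

(* [sup] is 0 on a set without a supremum. This does not happen when C is a
   pointed cone with interior in dimension at least 1, A is C-coconvex and x is
   in the polar cone: C `\` A is then nonempty, because C has infinite volume,
   and the products are bounded above by 0. *)
Definition supp C A x : R := - sup [set dot x y | y in C `\` A].

Definition Lp_supp C (p a1 a2 : R) A1 A2 x : R :=
  (a1 * supp C A1 x `^ p + a2 * supp C A2 x `^ p) `^ p^-1.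

Definition Lp_sum C (p a1 a2 : R) A1 A2 : set 'rV[R]_n :=
  C `\` (C `&` \bigcap_(u in Omega C) halfspace u (- Lp_supp C p a1 a2 A1 A2 u)).

End Defs.

(* Main.v *)
Require Import Defs.
From HB Require Import structures.
From mathcomp Require Import all_boot all_order all_algebra.
From mathcomp Require finmap.
From mathcomp Require Import all_classical all_reals all_analysis.
From mathcomp Require Import measurable_realfun lra ring.

Set Implicit Arguments.
Unset Strict Implicit.
Unset Printing Implicit Defensive.

Import Order.TTheory GRing.Theory Num.Theory.
Import numFieldNormedType.Exports.

Local Open Scope classical_set_scope.
Local Open Scope ring_scope.

(* Write K_i for the complement of A_i in C, h_i for the support function of A_i,
   and M for the p-mean with weights a1, a2. A nonempty A_i contains the vertex
   and K_i is nonempty, since otherwise A_i would contain arbitrarily large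
   cubes; hence h_i > 0 on the interior of the polar cone, which is nonempty by
   separation and compactness because C is pointed.

   As M is the infimum of its tangent linear forms l1 s + l2 t, every point
   l1 y1 + l2 y2 with y_i in K_i lies in the complement K of the Lp sum. Choosing
   the tangent at (h_1 x, h_2 x) shows that the supremum of dot x over K is at
   least - M (h_1 x) (h_2 x); the reverse inequality is the definition of K.
   Since M s t <= (a1 + a2)^(1/p) max s t, the Lp sum is contained in the dilation
   of A1 union A2 by (a1 + a2)^(1/p), which has finite volume.

   Lebesgue outer measure of a cube is bounded below by integrating the
   covering inequality between indicator functions one coordinate at a time. *)

(** * Lower bound for the Lebesgue outer measure of a box *)

Lemma integral_scaled_indic (R : realType) (r a b : R) : 0 <= r -> a <= b ->
  (\int[lebesgue_measure]_t (r * \1_`[a, b] t)%:E)%E = (r * (b - a))%:E.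
Proof.
move=> r0 ab; under eq_integral do rewrite EFinM.
rewrite ge0_integralZl_EFin//; last exact/measurable_EFinP/measurable_indic.
rewrite integral_indic//= setIT lebesgue_measure_itv/= lte_fin.
move: ab; rewrite le_eqVlt => /predU1P[->|->].
  by rewrite ltxx subrr mulr0 mule0.
by rewrite -EFinB -EFinM.
Qed.

(** Induction over the coordinates in [s]: the head indicator is integrated and the resulting length
    is absorbed into [c] and [w], which is why arbitrary nonnegative weights are allowed. *)
Lemma prod_len_le_series (R : realType) (I : eqType) (s : seq I) (c : R)
    (A B : I -> R) (w : nat -> R) (a b : nat -> I -> R) :
  uniq s -> 0 <= c -> (forall k, 0 <= w k) ->
  (forall i, A i <= B i) -> (forall k i, a k i <= b k i) ->
  (forall x : I -> R, ((c * \prod_(i <- s) \1_`[A i, B i] (x i))%:E <=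
     \sum_(0 <= k <oo) (w k * \prod_(i <- s) \1_`[a k i, b k i] (x i))%:E)%E) ->
  ((c * \prod_(i <- s) (B i - A i))%:E <=
     \sum_(0 <= k <oo) (w k * \prod_(i <- s) (b k i - a k i))%:E)%E.
Proof.
move=> + + + AB ab; elim: s c w => [|i s IH] c w /=.
  by move=> _ _ _ /(_ (fun=> 0)); rewrite !big_nil; under eq_eseriesr do rewrite big_nil;
     under [X in _ -> (_ <= X)%E]eq_eseriesr do rewrite big_nil.
move=> /andP[si us] c0 w0 H; rewrite big_cons mulrA.
under eq_eseriesr do rewrite big_cons mulrA.
apply: IH => //; first by rewrite mulr_ge0// subr_ge0.
  by move=> k; rewrite mulr_ge0// subr_ge0.
(* Each length is written back as an integral over coordinate [i], the other coordinates [x] being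
   fixed. *)
move=> x; rewrite mulrAC -integral_scaled_indic//; last first.
  by rewrite mulr_ge0// prodr_ge0.
under eq_eseriesr => k _.
  rewrite mulrAC -integral_scaled_indic//; last by rewrite mulr_ge0// prodr_ge0.
  over.
have mE (r u v : R) : measurable_fun setT (fun t => (r * \1_`[u, v] t)%:E).
  by apply/measurable_EFinP/measurable_funM => //; exact: measurable_indic.
(* Monotone convergence moves the series inside the integral; only the integrands remain to be
   compared. *)
rewrite -integral_nneseries//; last 2 first.
- by move=> k; exact: mE.
- by move=> k t _; rewrite lee_fin !mulr_ge0// prodr_ge0.
apply: ge0_le_integral => //.
- by move=> t _; rewrite lee_fin !mulr_ge0// prodr_ge0.
- exact: mE.
- apply: ge0_emeasurable_sum => [k t _ _|k _]; last exact: mE.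
  by rewrite lee_fin !mulr_ge0// prodr_ge0.
(* The hypothesis is taken with coordinate [i] set to [t]; as [s] has no duplicates, the other
   factors do not change. *)
move=> t _; have := H (fun j => if j == i then t else x j).
rewrite big_cons eqxx mulrA mulrAC.
under eq_eseriesr do rewrite big_cons eqxx mulrA mulrAC.
have xs (u v : I -> R) : \prod_(j <- s) \1_`[u j, v j] (if j == i then t else x j) =
    \prod_(j <- s) \1_`[u j, v j] (x j) :> R.
  apply: eq_big_seq => j js; case: eqP => // ji.
  by rewrite -ji js in si.
by rewrite xs; under eq_eseriesr do rewrite xs.
Qed.

Lemma nneseries_ge_term (R : realType) (u : nat -> \bar R) k :
  (forall i, 0 <= u i)%E -> (u k <= \sum_(0 <= i <oo) u i)%E.
Proof.
move=> u0; apply: le_trans (nneseries_lim_ge k.+1 _) => //.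
by rewrite big_nat_recr//= leeDr// sume_ge0.
Qed.

Lemma prod_indicE (R : realType) n (a b x : 'rV[R]_n) :
  \prod_(i < n) \1_`[a 0 i, b 0 i] (x 0 i) = (x \in box a b)%:R :> R.
Proof.
have [|/negP xab] := boolP (x \in box a b).
  rewrite inE => xab; rewrite big1// => i _.
  by rewrite indicE mem_set//= in_itv/=.
have [i /negP xi] : exists i, ~ a 0 i <= x 0 i <= b 0 i.
  by apply/existsNP => xi; apply: xab; rewrite inE.
rewrite (bigD1 i)//= indicE memNset ?mul0r//=.
by rewrite in_itv/=; exact/negP.
Qed.

Lemma volume_ge_box (R : realType) n (A : set 'rV[R]_n) (l u : 'rV[R]_n) :
  (forall i, l 0 i <= u 0 i) -> box l u `<=` A ->
  ((\prod_(i < n) (u 0 i - l 0 i))%:E <= volume A)%E.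
Proof.
move=> lu luA; apply: le_ereal_inf_tmp => _ [a [b [ab Aab ->]]].
rewrite -[X in X%:E]mul1r; under eq_eseriesr do rewrite -[X in X%:E]mul1r.
apply: (@prod_len_le_series _ _ (index_enum 'I_n) 1 (l 0) (u 0) (fun=> 1)
  (fun k => a k 0) (fun k => b k 0)) => // [|x].
  exact: index_enum_uniq.
pose y := \row_i x i.
have xE (v w : 'rV[R]_n) : \prod_(i < n) \1_`[v 0 i, w 0 i] (x i) = (y \in box v w)%:R :> R.
  by rewrite -prod_indicE; apply: eq_bigr => i _; rewrite mxE.
rewrite mul1r xE; under eq_eseriesr do rewrite mul1r xE.
have [|_] := boolP (y \in _); last by apply: nneseries_ge0 => k _; rewrite lee_fin.
(* The point lies in some box [k] of the cover, and the [k]-th term alone already equals 1. *)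
rewrite inE => /luA/Aab[k _ yk].
apply: le_trans (@nneseries_ge_term _ (fun k => ((y \in box (a k) (b k))%:R : R)%:E) k _) => //=.
  by rewrite mem_set.
Qed.

(** * Monotonicity of the outer measure, and its finiteness under unions and dilations *)

Lemma volume_le (R : realType) n (A B : set 'rV[R]_n) :
  A `<=` B -> (volume A <= volume B)%E.
Proof.
move=> AB; apply: ereal_inf_le_tmp => _ [a [b [ab Bab ->]]]; exists a, b; split => //.
exact: subset_trans Bab.
Qed.

Lemma volume_ltyP (R : realType) n (A : set 'rV[R]_n) : (volume A < +oo)%E ->
  exists a b : nat -> 'rV[R]_n, [/\ forall k i, a k 0 i <= b k 0 i,
        A `<=` \bigcup_k box (a k) (b k) &
        (\sum_(0 <= k <oo) (\prod_(i < n) (b k 0 i - a k 0 i))%:E < +oo)%E].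
Proof. by move=> /ereal_inf_lt[_ [a [b [ab Aab ->]]] soo]; exists a, b. Qed.

(** The two covers are interleaved, even indices for [A] and odd ones for [B]. *)
Lemma volumeU_lty (R : realType) n (A B : set 'rV[R]_n) :
  (volume A < +oo)%E -> (volume B < +oo)%E -> (volume (A `|` B) < +oo)%E.
Proof.
move=> /volume_ltyP[a [b [ab Aab soo]]] /volume_ltyP[a' [b' [ab' Bab soo']]].
pose v (f g : nat -> 'rV[R]_n) k := if odd k then g k./2 else f k./2.
pose F (a b : nat -> 'rV[R]_n) k := (\prod_(i < n) (b k 0 i - a k 0 i))%:E.
have F0 (f g : nat -> 'rV[R]_n) : (forall k i, f k 0 i <= g k 0 i) -> forall k, (0 <= F f g k)%E.
  by move=> fg k; rewrite lee_fin prodr_ge0// => i _; rewrite subr_ge0.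
have vv k i : v a a' k 0 i <= v b b' k 0 i by rewrite /v; case: ifP.
apply: (@le_lt_trans _ _ (\sum_(0 <= k <oo) F a b k + \sum_(0 <= k <oo) F a' b' k)%E); last first.
  exact: lte_add_pinfty.
apply: (@le_trans _ _ (\sum_(0 <= k <oo) F (v a a') (v b b') k)%E).
  apply: ereal_inf_lbound; exists (v a a'), (v b b'); split => // x [/Aab|/Bab] [k _ xk].
    by exists k.*2 => //; rewrite /v odd_double doubleK.
  by exists k.*2.+1 => //; rewrite /v /= odd_double/= uphalf_double.
have even_sum m : (\sum_(0 <= k < m.*2) F (v a a') (v b b') k =
    \sum_(0 <= k < m) F a b k + \sum_(0 <= k < m) F a' b' k)%E.
  elim: m => [|m IH]; first by rewrite !big_geq// adde0.
  rewrite doubleS !big_nat_recr//= IH /F /v /= odd_double/= uphalf_double doubleK.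
  by rewrite -addeA addeACA.
apply: lime_le; first by apply: is_cvg_nneseries => k _ _; exact: F0.
(* A partial sum of length [m] is at most the one of length [2m], which splits into partial sums of
   the two series. *)
apply: nearW => m; apply: (@le_trans _ _ (\sum_(0 <= k < m.*2) F (v a a') (v b b') k)%E).
  rewrite (@big_cat_nat _ _ _ m 0 m.*2)//=; last by rewrite -addnn leq_addr.
  by rewrite leeDl// sume_ge0// => k _; exact: F0.
by rewrite even_sum leeD// nneseries_lim_ge// => *; exact: F0.
Qed.

Lemma volumeZ_lty (R : realType) n (A : set 'rV[R]_n) (l : R) : 0 < l ->
  (volume A < +oo)%E -> (volume [set l *: x | x in A] < +oo)%E.
Proof.
move=> l0 /volume_ltyP[a [b [ab Aab soo]]].
apply: (@le_lt_trans _ _ ((l ^+ n)%:E * \sum_(0 <= k <oo) (\prod_(i < n) (b k 0 i - a k 0 i))%:E)%E); last first.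
  by rewrite lte_mul_pinfty// lee_fin exprn_ge0// ltW.
apply: ereal_inf_lbound; exists (fun k => l *: a k), (fun k => l *: b k); split.
- by move=> k i; rewrite !mxE ler_pM2l.
- move=> _ [x /Aab[k _ xk] <-]; exists k => // i; rewrite !mxE !ler_pM2l//.
- rewrite -nneseriesZl; last first.
    by move=> k _; rewrite lee_fin prodr_ge0// => i _; rewrite subr_ge0.
  apply: eq_eseriesr => k _; rewrite -EFinM; congr EFin.
  have -> : l ^+ n = \prod_(i < n) l by rewrite prodr_const card_ord.
  rewrite -big_split/=.
  by apply: eq_bigr => i _; rewrite !mxE mulrBr.
Qed.

(** * Weighted [p]-means and their tangent linear forms *)

Lemma powR_le_tangent (R : realType) (p r : R) : 0 < p < 1 -> 0 <= r ->
  r `^ p <= 1 + p * (r - 1).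
Proof.
move=> /andP[p0 p1] r0; have q0 : 0 < 1 - p by rewrite subr_gt0.
(* Young's inequality for [r ^ p] and 1, with conjugate exponents [1/p] and [1/(1 - p)]. *)
have := @conjugate_powR _ (r `^ p) 1 p^-1 (1 - p)^-1 (powR_ge0 _ _) ler01.
rewrite !invr_gt0 !invrK => /(_ p0 q0); rewrite subrKC => /(_ erefl).
rewrite mulr1 -powRrM mulfV ?gt_eqF// powRr1// powR1 => /le_trans; apply.
by lra.
Qed.

(** The scalar function behind [Lp_supp], kept convertible to it so that either form can replace the
    other. *)
Definition pmean (R : realType) (p a1 a2 s t : R) : R :=
  (a1 * s `^ p + a2 * t `^ p) `^ p^-1.

Section Pmean.
Context (R : realType) (p a1 a2 : R).
Hypotheses (p01 : 0 < p < 1) (a1_ge0 : 0 <= a1) (a2_ge0 : 0 <= a2).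

Let p_gt0 : 0 < p. Proof. by case/andP: p01. Qed.

Lemma powRVK (x : R) : 0 <= x -> (x `^ p^-1) `^ p = x.
Proof. by move=> x0; rewrite -powRrM mulVf ?gt_eqF// powRr1. Qed.

Lemma powRKV (x : R) : 0 <= x -> (x `^ p) `^ p^-1 = x.
Proof. by move=> x0; rewrite -powRrM mulfV ?gt_eqF// powRr1. Qed.

Lemma pmean_le (s t q : R) : 0 <= q ->
  a1 * s `^ p + a2 * t `^ p <= q `^ p -> pmean p a1 a2 s t <= q.
Proof.
move=> q0 stq; rewrite -[leRHS]powRKV//; apply: ge0_ler_powR => //.
- by rewrite invr_ge0 ltW.
- by rewrite nnegrE addr_ge0// mulr_ge0// powR_ge0.
- by rewrite nnegrE powR_ge0.
Qed.

Lemma pmeanZ (l s t : R) : 0 <= l -> 0 <= s -> 0 <= t ->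
  pmean p a1 a2 (l * s) (l * t) = l * pmean p a1 a2 s t.
Proof.
move=> l0 s0 t0; rewrite /pmean !powRM// !(mulrCA _ (l `^ p)) -mulrDr.
by rewrite powRM ?powR_ge0// ?powRKV// addr_ge0// mulr_ge0// powR_ge0.
Qed.

Lemma pmean_le_max (s t q : R) : 0 <= s <= q -> 0 <= t <= q ->
  pmean p a1 a2 s t <= (a1 + a2) `^ p^-1 * q.
Proof.
move=> /andP[s0 sq] /andP[t0 tq]; have q0 := le_trans s0 sq.
apply: pmean_le; first by rewrite mulr_ge0// powR_ge0.
rewrite powRM ?powR_ge0// powRVK ?addr_ge0// mulrDl.
by rewrite lerD// ler_wpM2l// ge0_ler_powR// ?nnegrE// ltW.
Qed.

Hypothesis a12_neq0 : ~ (a1 = 0 /\ a2 = 0).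

Lemma weight_gt0 : 0 < a1 + a2.
Proof.
rewrite lt_neqAle addr_ge0// andbT eq_sym paddr_eq0//.
by apply/andP => -[/eqP a10 /eqP a20]; exact: a12_neq0.
Qed.

Lemma pmean_arg_gt0 (s t : R) : 0 < s -> 0 < t -> 0 < a1 * s `^ p + a2 * t `^ p.
Proof.
move=> s0 t0; have [a1p|] := ltP 0 a1.
  by rewrite ltr_pwDl ?mulr_gt0 ?mulr_ge0 ?powR_gt0 ?powR_ge0.
move=> a1n; have a10 : a1 = 0 by apply/eqP; rewrite eq_le a1n.
rewrite a10 mul0r add0r mulr_gt0 ?powR_gt0// lt_neqAle a2_ge0 andbT eq_sym.
by apply/eqP => a20; exact: a12_neq0.
Qed.

Lemma pmean_gt0 (s t : R) : 0 < s -> 0 < t -> 0 < pmean p a1 a2 s t.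
Proof. by move=> s0 t0; rewrite powR_gt0// pmean_arg_gt0. Qed.

(* The p-mean is concave and 1-homogeneous, hence the infimum of its tangent
   linear forms. *)
Lemma pmean_tangent (s t : R) : 0 < s -> 0 < t -> exists l1 l2 : R,
  [/\ 0 <= l1, 0 <= l2, pmean p a1 a2 s t = l1 * s + l2 * t &
      forall s' t', 0 < s' -> 0 < t' -> pmean p a1 a2 s' t' <= l1 * s' + l2 * t'].
Proof.
move=> s0 t0; set m := pmean p a1 a2 s t.
have m0 : 0 < m by exact: pmean_gt0.
have mpE : m `^ p = a1 * s `^ p + a2 * t `^ p.
  by rewrite powRVK// ltW// pmean_arg_gt0.
have mp0 : 0 < m `^ p by rewrite powR_gt0.
(* The shares of the two summands in [m ^ p]. The coefficients [m * w1 / s] and [m * w2 / t] are the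
   partial derivatives of the mean at [(s, t)]. *)
pose w1 := a1 * s `^ p / m `^ p; pose w2 := a2 * t `^ p / m `^ p.
have w10 : 0 <= w1 by rewrite divr_ge0 ?mulr_ge0 ?powR_ge0.
have w20 : 0 <= w2 by rewrite divr_ge0 ?mulr_ge0 ?powR_ge0.
have w12 : w1 + w2 = 1 by rewrite -mulrDl -mpE divff// gt_eqF.
have sn : s != 0 by rewrite gt_eqF. have tn : t != 0 by rewrite gt_eqF.
have mn : m != 0 by rewrite gt_eqF.
have l10 : 0 <= m * w1 / s by apply: divr_ge0; [apply: mulr_ge0 => //|]; exact: ltW.
have l20 : 0 <= m * w2 / t by apply: divr_ge0; [apply: mulr_ge0 => //|]; exact: ltW.
exists (m * w1 / s), (m * w2 / t); split => //.
- by rewrite !mulfVK// -mulrDr w12 mulr1.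
move=> s' t' s'0 t'0; set q := _ + _.
have q0 : 0 < q.
  have [w1p|w1n] := ltP 0 w1.
    by apply: ltr_pwDl; [exact: mulr_gt0 (divr_gt0 (mulr_gt0 _ _) _) _|apply: mulr_ge0 => //; exact: ltW].
  have w2p : 0 < w2 by lra.
  by apply: ltr_wpDl; [apply: mulr_ge0 => //; exact: ltW|exact: mulr_gt0 (divr_gt0 (mulr_gt0 _ _) _) _].
have qn : q != 0 by rewrite gt_eqF.
(* The tangent inequality for powers is applied to the ratio [r' * m / (r * q)]. With weights [w1],
   [w2] the two ratios average to 1, so the linear terms cancel in the sum and [q ^ p] remains. *)
have bound a r r' : 0 <= a -> 0 < r -> 0 < r' ->
    a * r' `^ p <= a * r `^ p / m `^ p * (q `^ p * (1 + p * (r' * m / (r * q) - 1))).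
  move=> a0 r0 r'0; have z0 : 0 <= r' * m / (r * q) by rewrite divr_ge0 ?mulr_ge0// ltW.
  have -> : a * r' `^ p = a * r `^ p / m `^ p * (q `^ p * (r' * m / (r * q)) `^ p).
    rewrite -powRM ?(ltW q0)//.
    have -> : q * (r' * m / (r * q)) = r' / r * m by field; rewrite qn gt_eqF.
    have r'r0 : 0 <= r' / r by rewrite divr_ge0 ?ltW.
    rewrite powRM ?(ltW m0)// -[in LHS](divfK (_ : r != 0) r') ?gt_eqF//.
    rewrite (powRM _ r'r0 (ltW r0)).
    by field; rewrite gt_eqF.
  apply: ler_wpM2l; first by rewrite divr_ge0 ?mulr_ge0 ?powR_ge0.
  by apply: ler_wpM2l; rewrite ?powR_ge0// powR_le_tangent.
apply: pmean_le; first exact: ltW.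
apply: le_trans (lerD (bound _ _ _ a1_ge0 s0 s'0) (bound _ _ _ a2_ge0 t0 t'0)) _.
rewrite -/w1 -/w2.
have -> : w1 * (q `^ p * (1 + p * (s' * m / (s * q) - 1))) +
   w2 * (q `^ p * (1 + p * (t' * m / (t * q) - 1))) =
   q `^ p * ((w1 + w2) * (1 - p) + p * ((m * w1 / s * s' + m * w2 / t * t') / q)).
  by field; rewrite sn tn qn.
by rewrite -/q divff// w12 !mul1r mulr1 subrK mulr1.
Qed.

End Pmean.

(** * The scalar product compared with the maximum norm *)

Section Dot.
Context (R : realType) (n : nat).
Implicit Types x y z u v : 'rV[R]_n.

Lemma dotC x y : dot x y = dot y x.
Proof. by apply: eq_bigr => i _; rewrite mulrC. Qed.

Lemma dotDl x y z : dot (x + y) z = dot x z + dot y z.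
Proof. by rewrite -big_split; apply: eq_bigr => i _; rewrite mxE mulrDl. Qed.

Lemma dotZl (l : R) x y : dot (l *: x) y = l * dot x y.
Proof. by rewrite mulr_sumr; apply: eq_bigr => i _; rewrite mxE mulrA. Qed.

Lemma dotNl x y : dot (- x) y = - dot x y.
Proof. by rewrite -scaleN1r dotZl mulN1r. Qed.

Lemma dotDr x y z : dot x (y + z) = dot x y + dot x z.
Proof. by rewrite dotC dotDl !(dotC x). Qed.

Lemma dotZr (l : R) x y : dot x (l *: y) = l * dot x y.
Proof. by rewrite dotC dotZl dotC. Qed.

Lemma dotNr x y : dot x (- y) = - dot x y.
Proof. by rewrite dotC dotNl dotC. Qed.

Lemma dot0l x : dot 0 x = 0.
Proof. by rewrite -(scale0r 0) dotZl mul0r. Qed.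

Lemma dot0r x : dot x 0 = 0.
Proof. by rewrite dotC dot0l. Qed.

Lemma continuous_dot2 (T : topologicalType) (f g : T -> 'rV[R]_n) :
  continuous f -> continuous g -> continuous (fun t => dot (f t) (g t)).
Proof.
move=> cf cg t; rewrite /dot.
apply: cvg_big => [|i _]; first by move=> x; exact: add_continuous.
have coord (h : T -> 'rV[R]_n) : continuous h -> {for t, continuous (fun s => h s 0 i)}.
  by move=> ch; apply: (@continuous_comp _ _ _ h (fun x => x 0 i)); [exact: ch|exact: coord_continuous].
exact: cvgM (coord _ cf) (coord _ cg).
Qed.

Lemma continuous_dot u : continuous (dot u).
Proof.
apply: continuous_dot2 => y; last exact: cvg_id.
exact: (cst_continuous (x := u)).
Qed.

Lemma le_coord_norm x i : `|x 0 i| <= `|x|.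
Proof. by rewrite [leRHS]/Num.norm/= mx_normrE; apply/bigmax_geP; right => /=; exists (0, i). Qed.

Lemma norm_le_coord x (r : R) : 0 <= r -> (forall i, `|x 0 i| <= r) -> `|x| <= r.
Proof.
move=> r0 xr; rewrite [leLHS]/Num.norm/= mx_normrE; apply/bigmax_leP; split => // -[i j] _.
by rewrite ord1 xr.
Qed.

(** The maximum norm is attained at one coordinate, whose square is a term of [dot x x]. *)
Lemma norm_sqr_le_dot x : `|x| ^+ 2 <= dot x x.
Proof.
have [->|x0] := eqVneq x 0.
  by rewrite normr0 expr0n/= sumr_ge0// => i _; rewrite -expr2 sqr_ge0.
have /mx_norm_neq0[[i j]] : mx_norm x != 0 by rewrite -[mx_norm x]/`|x| normr_eq0.
rewrite ord1 -[mx_norm x]/`|x| /= => ->; rewrite real_normK ?num_real// /dot (bigD1 j)//=.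
by rewrite -expr2 lerDl sumr_ge0// => k _; rewrite -expr2 sqr_ge0.
Qed.

Lemma dot_gt0 x : x != 0 -> 0 < dot x x.
Proof.
by move=> x0; apply: lt_le_trans (norm_sqr_le_dot x); rewrite exprn_gt0// normr_gt0.
Qed.

Lemma dot_le_norm x y : dot x y <= n%:R * `|x| * `|y|.
Proof.
rewrite -mulrA mulr_natl -[X in _ *+ X]card_ord -sumr_const.
apply: ler_sum => i _; apply: le_trans (ler_norm _) _; rewrite normrM.
by rewrite ler_pM ?le_coord_norm.
Qed.

End Dot.

(** * Convexity, pointed cones and their polars *)

Lemma convex_setP (R : realType) n (A : set 'rV[R]_n) :
  convex_set (A : set (convex_lmodType 'rV[R]_n)) <->
  (forall x y (t : R), A x -> A y -> 0 <= t <= 1 -> A (t *: x + (1 - t) *: y)).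
Proof.
split=> [cA x y t Ax Ay /andP[t0 t1]|cA x y t].
  by have /set_mem := cA x y (Itv01 t0 t1) (mem_set Ax) (mem_set Ay).
move=> /set_mem Ax /set_mem Ay; apply/mem_set; apply: cA => //.
by rewrite ge0 le1.
Qed.

Section PointedCone.
Context (R : realType) (n : nat) (C : set 'rV[R]_n).
Hypotheses (n0 : (0 < n)%N) (coneC : pointed_cone C).
Implicit Types (A : set 'rV[R]_n) (x y z u v : 'rV[R]_n).

Lemma coneZ x (l : R) : C x -> 0 <= l -> C (l *: x).
Proof. by case: coneC => ? ? + ? ?; exact. Qed.

Lemma coneD x y : C x -> C y -> C (x + y).
Proof.
case: coneC => _ /convex_setP cC _ _ _ Cx Cy.
have h : 0 <= (2^-1 : R) <= 1 by lra.
have := @coneZ _ 2 (cC _ _ _ Cx Cy h) (ler0n _ _).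
have -> : 1 - 2^-1 = 2^-1 :> R by lra.
by rewrite -scalerDr scalerA mulfV// scale1r.
Qed.

Lemma cone0 : C 0.
Proof. by case: coneC => _ _ _ _ [x /interior_subset Cx]; rewrite -(scale0r x); exact: coneZ. Qed.

Lemma cone_opp x : C x -> C (- x) -> x = 0.
Proof.
case: coneC => _ _ _ CC0 _ Cx CNx; have : (C `&` [set - x | x in C]) x.
  by split => //; exists (- x); rewrite ?opprK.
by rewrite CC0.
Qed.

Lemma cone_nonzero : exists2 x, C x & x != 0.
Proof.
case: coneC => _ _ _ _ [e /nbhs_ballP[r/= r0 eC]].
have [e0|e0] := eqVneq e 0; last first.
  by exists e => //; apply: eC; exact: ballxx.
(* When the interior point is the origin, a constant vector of norm at most [r / 2] stays in the
   ball. *)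
exists (const_mx (r / 2)).
  apply: eC; rewrite -ball_normE/= e0 sub0r normrN.
  apply: le_lt_trans (_ : r / 2 < r); last lra.
  by apply: norm_le_coord => [|i]; rewrite ?mxE ?ger0_norm; lra.
apply/eqP => /rowP/(_ (Ordinal n0)); rewrite !mxE; lra.
Qed.

(** Forwards, [x] is pushed by [r / 2] in the direction of [y] and remains polar. Backwards, a
    perturbation of norm below [d / n] changes the product by at most [d * |y|], the factor [n]
    coming from [dot_le_norm]. *)
Lemma interior_polarP x : interior (polar C) x <->
  exists2 d : R, 0 < d & forall y, C y -> dot x y <= - d * `|y|.
Proof.
split=> [/nbhs_ballP[r/= r0 xr]|[d d0 xd]].
  exists (r / 2); first lra.
  move=> y Cy; have [->|y0] := eqVneq y 0; first by rewrite normr0 mulr0 dot0r.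
  have ny : 0 < `|y| by rewrite normr_gt0.
  have /xr/(_ _ Cy) : ball x r (x + (r / 2 / `|y|) *: y).
    rewrite -ball_normE/= opprD addNKr normrN normrZ ger0_norm ?divr_ge0//; last lra.
    by rewrite divfK ?gt_eqF//; lra.
  rewrite dotDl dotZl => h.
  have : r / 2 / `|y| * `|y| ^+ 2 <= r / 2 / `|y| * dot y y.
    by rewrite ler_wpM2l ?norm_sqr_le_dot// divr_ge0//; lra.
  by rewrite expr2 mulrA divfK ?gt_eqF//; lra.
have N0 : 0 < n%:R :> R by rewrite ltr0n.
apply/nbhs_ballP; exists (d / n%:R) => /=; first by rewrite divr_gt0.
move=> z; rewrite -ball_normE/= distrC => zx y Cy.
rewrite -(subrK x z) dotDl.
have := xd y Cy; have := dot_le_norm (z - x) y.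
have : n%:R * `|z - x| * `|y| <= d * `|y|.
  by rewrite ler_wpM2r// -ler_pdivlMl// mulrC ltW.
lra.
Qed.

Lemma interior_polarZ x (l : R) : 0 < l -> interior (polar C) x -> interior (polar C) (l *: x).
Proof.
move=> l0 /interior_polarP[d d0 xd]; apply/interior_polarP.
exists (l * d); first by rewrite mulr_gt0.
by move=> y Cy; rewrite dotZl -mulrN -mulrA ler_pM2l// xd.
Qed.

(* Nearest-point projection: if [y] is the point of [C] closest to [x], then
   [x - y] is in the polar cone and [dot (x - y) y >= 0]. *)
Lemma cone_separation x : ~ C x -> exists2 u, polar C u & 0 < dot u x.
Proof.
move=> nCx; pose f y := dot (x - y) (x - y).
(* Beyond norm [M] a point is at least as far from [x] as the origin is, because
   [(1 + dot x x) ^ 2 >= dot x x]; a minimum over the truncated cone is thus global. *)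
pose M := `|x| + 1 + dot x x.
have cf : continuous f.
  have cxy : continuous (fun y => x - y).
    by move=> y; apply: continuousB; [exact: cst_continuous|exact: cvg_id].
  exact: (continuous_dot2 cxy cxy).
have xx0 : 0 <= dot x x by apply: le_trans (norm_sqr_le_dot x); rewrite sqr_ge0.
have cK : compact (C `&` [set y | `|y| <= M]).
  apply: bounded_closed_compact.
    by exists M; split; [exact: num_real|move=> r /ltW Mr y [_ /le_trans]; exact].
  apply: closedI; first by case: coneC.
  apply: (@preimage_closed _ _ (fun y : 'rV[R]_n => `|y|) [set r | r <= M]); last exact: closed_le.
  by move=> y _; exact: norm_continuous.
have K0 : C 0 /\ `|0 : 'rV[R]_n| <= M by split; [exact: cone0|rewrite normr0 /M !addr_ge0].
have [y0] := EVT_min_rV (ex_intro _ 0 K0) cK (continuous_subspaceT cf).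
rewrite inE => -[Cy0 y0M] y0min.
have ymin y : C y -> f y0 <= f y.
  move=> Cy; have [yM|yM] := leP `|y| M; first by apply: y0min; rewrite inE.
  have /le_trans : f y0 <= f 0 by apply: y0min; rewrite inE.
  apply; rewrite /f subr0; apply: le_trans (norm_sqr_le_dot _).
  have h : 1 + dot x x <= `|x - y|.
    have := lerB_normD y (- x); rewrite normrN distrC /M in yM *; lra.
  have : (1 + dot x x) ^+ 2 <= `|x - y| ^+ 2 by rewrite ler_sqr// nnegrE// addr_ge0.
  apply: le_trans; rewrite expr2; nra.
have [u uE] : exists u, x - y0 = u by exists (x - y0).
have var v (t : R) : C (y0 + t *: v) -> 2 * t * dot u v <= t ^+ 2 * dot v v.
  move=> /ymin; rewrite /f opprD addrA uE.
  rewrite !(dotDl, dotDr, dotNl, dotNr, dotZl, dotZr) (dotC v u) expr2; lra.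
(* A linear term bounded by a quadratic one for small [t] has a nonpositive coefficient. The range
   stops at 1 so that [y0 - t *: y0] stays in the cone. *)
have small (c d : R) : 0 <= d -> (forall t, 0 < t <= 1 -> 2 * t * c <= t ^+ 2 * d) -> c <= 0.
  move=> d0 H; rewrite leNgt; apply/negP => c0.
  pose t := c / (c + d).
  have t01 : 0 < t <= 1.
    by rewrite divr_gt0 ?ltr_wpDr//= ler_pdivrMr ?ltr_wpDr// mul1r lerDl.
  have tcd : t * (c + d) = c by rewrite divfK// gt_eqF// ltr_wpDr.
  have := H _ t01; have /andP[tp t1] := t01; rewrite expr2 => Ht.
  have : 2 * c <= t * d by rewrite -(ler_pM2l tp); lra.
  nra.
have dvv v : 0 <= dot v v by apply: le_trans (norm_sqr_le_dot v); rewrite sqr_ge0.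
have pu : polar C u.
  move=> v Cv; apply: (small _ (dot v v)) => // t /andP[t0 _]; apply: var.
  by apply: coneD => //; apply: coneZ => //; exact: ltW.
exists u => //; have uy0 : 0 <= dot u y0.
  rewrite -oppr_le0 -dotNr; apply: (small _ (dot (- y0) (- y0))) => // t /andP[t0 t1].
  apply: var; rewrite scalerN -[X in X - _]scale1r -scalerBl; apply: coneZ => //; lra.
rewrite -(subrK y0 x) uE dotDr ltr_pwDl// dot_gt0// -uE subr_eq0.
by apply: contra_notN nCx => /eqP ->.
Qed.

(** For a unit vector [v] of [C], pointedness puts [- v] outside [C], and separation yields a polar
    vector negative at [v]. By compactness finitely many suffice; their sum is negative on all unit
    vectors of [C], and its maximum there gives the uniform constant. *)
Lemma interior_polar_nonempty : interior (polar C) !=set0.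
Proof.
have cS : compact (C `&` [set y | `|y| = 1]).
  apply: bounded_closed_compact.
    by exists 1; split; [exact: num_real|move=> r /ltW r1 y [_ /= ->]].
  apply: closedI; first by case: coneC.
  apply: (@preimage_closed _ _ (fun y : 'rV[R]_n => `|y|) [set 1]); last exact: closed_eq.
  by move=> y _; exact: norm_continuous.
have := cS; rewrite compact_cover => /(_ 'rV[R]_n (polar C) (fun u => [set v | dot u v < 0])).
case=> [u _|v [Cv /= v1]|D Dpolar Dcover].
- apply: (@open_comp _ _ (dot u) [set r | r < 0]) => [v _|]; last exact: open_lt.
  exact: continuous_dot.
- have /cone_separation[u pu] : ~ C (- v).
    move=> CNv; have v0 := cone_opp Cv CNv.
    by move: v1; rewrite v0 normr0 => /eqP; rewrite eq_sym oner_eq0.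
  by rewrite dotNr oppr_gt0; exists u.
pose u := \sum_(d <- finmap.enum_fset D) d.
have dotu v : dot u v = \sum_(d <- finmap.enum_fset D) dot d v.
  by rewrite /u; elim/big_rec2 : _ => [|i y1 y2 _ <-]; rewrite ?dot0l ?dotDl.
have u_neg v : C v -> `|v| = 1 -> dot u v < 0.
  move=> Cv v1; have [d /= dD dv] := Dcover v (conj Cv v1).
  rewrite dotu (big_rem d dD)/= ltr_nwDl// big_seq sumr_le0// => d' /mem_rem d'D.
  by have /set_mem := Dpolar _ d'D; exact.
have [e Ce e0] := cone_nonzero.
have normalize v : C v -> v != 0 -> C (`|v|^-1 *: v) /\ `| `|v|^-1 *: v | = 1.
  move=> Cv v0; split; first by apply: coneZ => //; rewrite invr_ge0.
  by rewrite normrZ ger0_norm ?invr_ge0// mulVf// normr_eq0.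
have [c] := EVT_max_rV (ex_intro _ _ (normalize _ Ce e0)) cS (continuous_subspaceT (@continuous_dot _ _ u)).
rewrite inE => -[Cc c1] cmax; exists u; apply/interior_polarP.
exists (- dot u c); first by rewrite oppr_gt0 u_neg.
move=> y Cy; have [->|y0] := eqVneq y 0; first by rewrite normr0 mulr0 dot0r.
have := cmax (`|y|^-1 *: y); rewrite inE => /(_ (normalize _ Cy y0)).
by rewrite dotZr mulrC ler_pdivrMr ?normr_gt0// opprK.
Qed.

(** The Lp sum only constrains directions in [Omega C]; this and homogeneity extend the bounds to
    the whole interior of the polar. The scaling is Euclidean, not by the maximum norm. *)
Lemma Omega_normalize x : interior (polar C) x ->
  exists2 l : R, 0 < l & Omega C (l *: x).
Proof.
move=> ix; have x0 : x != 0.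
  apply/eqP => x0; have [e Ce e0] := cone_nonzero.
  have /interior_polarP[d d0 /(_ _ Ce)] := ix; rewrite x0 dot0l.
  by rewrite mulNr oppr_ge0 leNgt mulr_gt0// normr_gt0.
have xx := dot_gt0 x0; exists (Num.sqrt (dot x x))^-1.
  by rewrite invr_gt0 sqrtr_gt0.
split; last by apply: interior_polarZ => //; rewrite invr_gt0 sqrtr_gt0.
rewrite /sphere/= dotZl dotZr mulrA -invfM -expr2 sqr_sqrtr ?(ltW xx)//.
by rewrite mulVf// gt_eqF.
Qed.

End PointedCone.

(** * Coconvex sets and their support functions *)

Section Coconvex.
Context (R : realType) (n : nat) (C : set 'rV[R]_n).
Hypotheses (n0 : (0 < n)%N) (coneC : pointed_cone C).
Implicit Types (A : set 'rV[R]_n) (x y z u v : 'rV[R]_n).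

(* If the complement of [A] is empty or contains the vertex, a small cube in
   [A] can be dilated from the vertex without leaving [A]. *)
Lemma coconvex_compl_without_vertex A : coconvex C A -> A !=set0 ->
  ~ (C `\` A !=set0 -> ~ A 0).
Proof.
move=> [AC volA closedK /convex_setP convK] [x Ax] HK.
have K0 : C `\` A !=set0 -> (C `\` A) 0.
  by move=> K; split; [exact: (cone0 coneC)|exact: HK].
have nKx : (~` (C `\` A)) x by move=> [].
have [r/= r0 xr] : exists2 r : R, 0 < r & ball x r `<=` ~` (C `\` A).
  by have /nbhs_ballP[r /= r0 ?] := open_nbhs_nbhs (conj (closed_openC closedK) nKx); exists r.
have [_ _ _ _ [e /nbhs_ballP[s/= s0 es]]] := coneC.
pose t := r / 2 / (`|e| + 1).
have e1 : 0 < `|e| + 1 by rewrite ltr_pwDr.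
have t0 : 0 < t by rewrite !divr_gt0.
have te : t * `|e| < r / 2.
  by rewrite /t mulrAC ltr_pdivrMr// ltr_pM2l ?divr_gt0// ltrDl.
have [z zE] : exists z, z = x + t *: e by exists (x + t *: e).
(* [rho < r / 2] keeps the cube around [z] in the ball about [x] that avoids the complement;
   [rho < t * s] keeps it in [C]. *)
pose rho := Num.min (r / 2) (t * s) / 2.
have m0 : 0 < Num.min (r / 2) (t * s) by rewrite lt_min divr_gt0// mulr_gt0.
have min_r : Num.min (r / 2) (t * s) <= r / 2 by rewrite ge_min lexx.
have min_s : Num.min (r / 2) (t * s) <= t * s by rewrite ge_min lexx orbT.
have [rho0 rho_r rho_s] : [/\ 0 < rho, rho < r / 2 & rho < t * s].
  by rewrite /rho; split; lra.
have cubeA w : `|w - z| <= rho -> A w.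
  move=> wz; have Cw : C w.
    have -> : w = x + t *: (e + t^-1 *: (w - z)).
      by rewrite scalerDr scalerA mulfV ?gt_eqF// scale1r addrA -zE subrKC.
    apply: (coneD coneC (AC _ Ax)); apply: (coneZ coneC); last exact: ltW.
    apply: es; rewrite -ball_normE/= opprD addNKr normrN normrZ gtr0_norm ?invr_gt0//.
    by rewrite mulrC ltr_pdivrMr// mulrC (le_lt_trans wz).
  apply: contrapT => nAw; apply: (xr w) => //.
  rewrite -ball_normE/= distrC; have -> : w - x = (w - z) + t *: e.
    by rewrite zE opprD addrA subrK.
  apply: le_lt_trans (ler_normD _ _) _; rewrite normrZ (gtr0_norm t0); lra.
(* Were [l *: w] in the complement, so would be [w], which lies on the segment from the vertex to
   [l *: w]. *)
have dilA w (l : R) : `|w - z| <= rho -> 1 <= l -> A (l *: w).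
  move=> wz l1; have l0 : 0 < l by lra.
  have Aw := cubeA _ wz; apply: contrapT => nAlw.
  have Klw : (C `\` A) (l *: w).
    by split => //; apply: (coneZ coneC); [exact: AC|exact: ltW].
  have li : 0 <= l^-1 <= 1 by rewrite invr_ge0 ltW// invf_le1.
  have := convK _ _ _ Klw (K0 (ex_intro _ _ Klw)) li.
  by rewrite scaler0 addr0 scalerA mulVf ?gt_eqF// scale1r => -[].
have vol_ge (l : R) : 1 <= l -> (((2 * l * rho) ^+ n)%:E <= volume A)%E.
  move=> l1; have l0 : 0 < l by lra.
  have lr0 : 0 < l * rho by rewrite mulr_gt0.
  pose c i := l * z 0 i.
  have := @volume_ge_box _ _ A (\row_i (c i - l * rho)) (\row_i (c i + l * rho)).
  have -> : \prod_(i < n) ((\row_i (c i + l * rho)) 0 i - (\row_i (c i - l * rho)) 0 i) =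
      \prod_(i < n) (2 * l * rho).
    by apply: eq_bigr => i _; rewrite !mxE; lra.
  rewrite prodr_const card_ord; apply => [i|y yb]; first by rewrite !mxE; lra.
  rewrite -[y]scale1r -(@mulfV _ l) ?gt_eqF// -scalerA; apply: dilA => //.
  apply: norm_le_coord => [|i]; first exact: ltW.
  have := yb i; rewrite !mxE /c => /andP[y1 y2].
  have yE : y 0 i = l * (l^-1 * y 0 i) by rewrite mulVKf// gt_eqF.
  rewrite ler_norml -(ler_pM2l l0) -[X in _ && X](ler_pM2l l0) !mulrBr -yE.
  by apply/andP; split; lra.
have := vol_ge; case: (volume A) volA => [v| |] // _ {}vol_ge; last first.
  by have := vol_ge 1 (lexx _).
(* Chosen so that the side [2 * l * rho] is at least 1 and exceeds [v]; its [n]-th power then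
   exceeds [v] too, as [n > 0]. *)
pose l := 1 + (1 + `|v|) / (2 * rho).
have rho2 : 0 < 2 * rho by rewrite mulr_gt0.
have l1 : 1 <= l by rewrite lerDl divr_ge0// ?ltW// addr_ge0.
have lE : 2 * l * rho = 2 * rho + (1 + `|v|).
  by rewrite /l; field; rewrite gt_eqF.
have := vol_ge l l1; rewrite lee_fin lE; apply/negP; rewrite -ltNge.
have h1 : 1 <= 2 * rho + (1 + `|v|) by have := normr_ge0 v; lra.
apply: lt_le_trans (_ : 2 * rho + (1 + `|v|) <= _).
  by have := ler_norm v; lra.
by rewrite -[leLHS]expr1 ler_weXn2l.
Qed.

Lemma coconvex_vertex A : coconvex C A -> A !=set0 -> A 0.
Proof.
by move=> cA A0; apply: contrapT => nA; apply: (coconvex_compl_without_vertex cA A0).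
Qed.

Lemma coconvex_compl_nonempty A : coconvex C A -> A !=set0 -> C `\` A !=set0.
Proof.
by move=> cA A0; apply: contrapT => nK; apply: (coconvex_compl_without_vertex cA A0).
Qed.

Lemma dot_le_supp A x y : polar C x -> (C `\` A) y -> dot x y <= - supp C A x.
Proof.
move=> px Ky; rewrite opprK; apply: ub_le_sup; last by exists y.
by exists 0 => _ [z [Cz _] <-]; exact: px.
Qed.

(** Nonemptiness of the complement rules out the default value of [sup] on the empty set. *)
Lemma le_supp A x (m : R) : C `\` A !=set0 ->
  (forall y, (C `\` A) y -> dot x y <= - m) -> m <= supp C A x.
Proof.
move=> [y0 Ky0] Km; rewrite lerNr; apply: ge_sup; first by exists (dot x y0), y0.
by move=> _ [y Ky <-]; exact: Km.
Qed.

Lemma supp_adherent A x (eps : R) : polar C x -> C `\` A !=set0 -> 0 < eps ->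
  exists2 y, (C `\` A) y & - supp C A x - eps < dot x y.
Proof.
move=> px [y0 Ky0] eps0.
have hs : has_sup [set dot x y | y in C `\` A].
  split; first by exists (dot x y0), y0.
  by exists 0 => _ [z [Cz _] <-]; exact: px.
have [_ [y Ky <-] ydot] := sup_adherent eps0 hs.
by exists y => //; rewrite opprK.
Qed.

Lemma suppZ A x (l : R) : C `\` A !=set0 -> polar C x -> 0 < l ->
  supp C A (l *: x) = l * supp C A x.
Proof.
move=> K0 px l0; have plx : polar C (l *: x).
  by move=> y Cy; rewrite dotZl pmulr_rle0// px.
apply/eqP; rewrite eq_le; apply/andP; split; last first.
  by apply: le_supp => // y Ky; rewrite dotZl -mulrN ler_pM2l// dot_le_supp.
rewrite mulrC -ler_pdivrMr//; apply: le_supp => // y Ky.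
by rewrite -mulNr ler_pdivlMr// mulrC -dotZl dot_le_supp.
Qed.

(** The complement is closed and omits the vertex, so it avoids a ball of radius [r]; the uniform
    bound on the polar interior then gives [d * r] as a lower bound. *)
Lemma supp_gt0 A x : coconvex C A -> A !=set0 -> interior (polar C) x ->
  0 < supp C A x.
Proof.
move=> cA A0 ix; have K0 := coconvex_compl_nonempty cA A0.
have [_ _ closedK _] := cA.
have nK0 : (~` (C `\` A)) 0 by move=> [_]; apply; exact: coconvex_vertex.
have /nbhs_ballP[r /= r0 rK] := open_nbhs_nbhs (conj (closed_openC closedK) nK0).
have /(interior_polarP C n0)[d d0 xd] := ix.
apply: lt_le_trans (_ : d * r <= _); first by rewrite mulr_gt0.
apply: le_supp => // y Ky; apply: le_trans (xd _ Ky.1) _.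
rewrite mulNr lerN2 ler_pM2l// leNgt; apply/negP => yr.
by apply: (rK y) => //; rewrite -ball_normE/= sub0r normrN.
Qed.

End Coconvex.

(** * The Lp sum: support function, nonemptiness and coconvexity *)

Section LpSum.
Context (R : realType) (n : nat) (C A1 A2 : set 'rV[R]_n) (p a1 a2 : R).
Hypotheses (n0 : (0 < n)%N) (coneC : pointed_cone C).
Hypotheses (cA1 : coconvex C A1) (A1_neq0 : A1 !=set0).
Hypotheses (cA2 : coconvex C A2) (A2_neq0 : A2 !=set0).
Hypotheses (p01 : 0 < p < 1) (a1_ge0 : 0 <= a1) (a2_ge0 : 0 <= a2).
Hypothesis a12_neq0 : ~ (a1 = 0 /\ a2 = 0).
Implicit Types x y u : 'rV[R]_n.

Lemma compl_Lp_sumP y : (C `\` Lp_sum C p a1 a2 A1 A2) y <->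
  C y /\ forall u, Omega C u -> dot y u <= - Lp_supp C p a1 a2 A1 A2 u.
Proof.
rewrite /Lp_sum setDD setIA setIid; split=> [[Cy Hy]|[Cy Hy]].
  by split=> // u Ou; exact: Hy.
by split=> // u Ou; exact: Hy.
Qed.

Let supp1_gt0 u (iu : interior (polar C) u) : 0 < supp C A1 u := supp_gt0 n0 coneC cA1 A1_neq0 iu.
Let supp2_gt0 u (iu : interior (polar C) u) : 0 < supp C A2 u := supp_gt0 n0 coneC cA2 A2_neq0 iu.
Let K1 := coconvex_compl_nonempty n0 coneC cA1 A1_neq0.
Let K2 := coconvex_compl_nonempty n0 coneC cA2 A2_neq0.

(** In a direction [u] the product is at most minus the linear form at the two support values, and
    this form majorizes the mean. *)
Lemma compl_Lp_sum_mix y1 y2 (l1 l2 : R) :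
  (C `\` A1) y1 -> (C `\` A2) y2 -> 0 <= l1 -> 0 <= l2 ->
  (forall s t, 0 < s -> 0 < t -> pmean p a1 a2 s t <= l1 * s + l2 * t) ->
  (C `\` Lp_sum C p a1 a2 A1 A2) (l1 *: y1 + l2 *: y2).
Proof.
move=> Ky1 Ky2 l10 l20 tangent; apply/compl_Lp_sumP; split.
  by apply: (coneD coneC); apply: (coneZ coneC) => //; [exact: Ky1.1|exact: Ky2.1].
move=> u [_ iu]; have pu := interior_subset iu.
rewrite dotC dotDr !dotZr.
have := tangent _ _ (supp1_gt0 iu) (supp2_gt0 iu).
rewrite -[pmean _ _ _ _ _]/(Lp_supp C p a1 a2 A1 A2 u).
have := ler_wpM2l l10 (dot_le_supp pu Ky1).
have := ler_wpM2l l20 (dot_le_supp pu Ky2).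
lra.
Qed.

Lemma supp_Lp_sum x : interior (polar C) x ->
  supp C (Lp_sum C p a1 a2 A1 A2) x = Lp_supp C p a1 a2 A1 A2 x.
Proof.
move=> ix; have px := interior_subset ix.
have [l1 [l2 [l10 l20 pmeanE tangent]]] :=
  pmean_tangent p01 a1_ge0 a2_ge0 a12_neq0 (supp1_gt0 ix) (supp2_gt0 ix).
rewrite -[Lp_supp _ _ _ _ _ _ _]/(pmean p a1 a2 (supp C A1 x) (supp C A2 x)).
apply/eqP; rewrite eq_le; apply/andP; split.
  apply/ler_addgt0Pr => eps eps0.
  have l0 : 0 < l1 + l2 + 1 by lra.
  (* Near-maximizers with error [d] cost [(l1 + l2) * d <= eps] in total; the added 1 keeps the
     denominator positive. *)
  pose d := eps / (l1 + l2 + 1).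
  have d0 : 0 < d by rewrite divr_gt0.
  have dE : d * (l1 + l2 + 1) = eps by rewrite divfK// gt_eqF.
  have [y1 Ky1 xy1] := supp_adherent px K1 d0.
  have [y2 Ky2 xy2] := supp_adherent px K2 d0.
  have := dot_le_supp px (compl_Lp_sum_mix Ky1 Ky2 l10 l20 tangent).
  rewrite dotDr !dotZr pmeanE.
  have := ler_wpM2l l10 (ltW xy1); have := ler_wpM2l l20 (ltW xy2).
  lra.
apply: le_supp => [|y /compl_Lp_sumP[Cy Ky]].
  have [y1 Ky1] := K1; have [y2 Ky2] := K2.
  by exists (l1 *: y1 + l2 *: y2); exact: compl_Lp_sum_mix.
(* The defining bound is available only at the unit vector [l *: x]; both sides are homogeneous, so
   [l] cancels. *)
have [l l0 Olx] := Omega_normalize n0 coneC ix.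
have := Ky _ Olx; rewrite dotC dotZl.
rewrite -[Lp_supp _ _ _ _ _ _ _]/(pmean p a1 a2 (supp C A1 (l *: x)) (supp C A2 (l *: x))).
rewrite (suppZ K1 px l0) (suppZ K2 px l0).
rewrite (pmeanZ p01 a1_ge0 a2_ge0 (ltW l0) (ltW (supp1_gt0 ix)) (ltW (supp2_gt0 ix))).
by rewrite -mulrN ler_pM2l.
Qed.

(** The vertex belongs to it: a halfspace in a direction of [Omega C] has a negative bound and
    excludes 0. *)
Lemma Lp_sum_nonempty : Lp_sum C p a1 a2 A1 A2 !=set0.
Proof.
have [x ix] := interior_polar_nonempty n0 coneC.
have [l l0 [Slx ilx]] := Omega_normalize n0 coneC ix.
exists 0; split; first exact: (cone0 coneC).
move=> [_ /(_ _ (conj Slx ilx))]; rewrite /halfspace/= dot0l oppr_ge0 leNgt.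
by rewrite (pmean_gt0 _ _ _ a12_neq0 (supp1_gt0 ilx) (supp2_gt0 ilx)).
Qed.

(* If [y] lies in both complements then [dot y u <= - max (h1 u) (h2 u)], and
   the p-mean is at most [(a1 + a2)^(1/p)] times the maximum. *)
Lemma Lp_sum_subset_dilation :
  Lp_sum C p a1 a2 A1 A2 `<=`
  [set (a1 + a2) `^ p^-1 *: x | x in A1 `|` A2].
Proof.
set M := _ `^ _; have M0 : 0 < M by rewrite powR_gt0 ?weight_gt0.
move=> y [Cy nKy]; exists (M^-1 *: y); last by rewrite scalerA mulfV ?gt_eqF// scale1r.
(* If the rescaled point were in neither [A1] nor [A2], it would lie in both complements, and [y]
   would satisfy every halfspace bound. *)
apply: contrapT => /not_orP[nA1 nA2]; apply: nKy; split=> // u [_ iu].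
have pu := interior_subset iu.
have Cz : C (M^-1 *: y) by apply: (coneZ coneC); rewrite // invr_ge0 ltW.
have h1 := dot_le_supp pu (conj Cz nA1); have h2 := dot_le_supp pu (conj Cz nA2).
have yE : dot u y = M * dot u (M^-1 *: y) by rewrite dotZr mulVKf// gt_eqF.
rewrite /halfspace/= dotC yE lerNr -mulrN.
apply: pmean_le_max => //; apply/andP; split; by [exact/ltW/supp1_gt0|exact/ltW/supp2_gt0|rewrite lerNr].
Qed.

Lemma coconvex_Lp_sum : coconvex C (Lp_sum C p a1 a2 A1 A2).
Proof.
have M0 : 0 < (a1 + a2) `^ p^-1 by rewrite powR_gt0 ?weight_gt0.
split; first by move=> x [].
- apply: le_lt_trans (volume_le Lp_sum_subset_dilation) _.
  by apply: volumeZ_lty => //; apply: volumeU_lty; [case: cA1|case: cA2].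
- have -> : C `\` Lp_sum C p a1 a2 A1 A2 =
      C `&` \bigcap_(u in Omega C) halfspace u (- Lp_supp C p a1 a2 A1 A2 u).
    by rewrite /Lp_sum setDD setIA setIid.
  apply: closedI; first by case: coneC.
  apply: closed_bigI => u _.
  have -> : halfspace u (- Lp_supp C p a1 a2 A1 A2 u) =
      dot u @^-1` [set r | r <= - Lp_supp C p a1 a2 A1 A2 u].
    by apply/seteqP; split=> x; rewrite /halfspace/= dotC.
  apply: preimage_closed; last exact: closed_le.
  by move=> x _; exact: continuous_dot.
- apply/convex_setP => x y t /compl_Lp_sumP[Cx Kx] /compl_Lp_sumP[Cy Ky] /andP[t0 t1].
  have t1' : 0 <= 1 - t by rewrite subr_ge0.
  apply/compl_Lp_sumP; split.
    by apply: (coneD coneC); apply: (coneZ coneC).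
  move=> u Ou; rewrite dotDl !dotZl.
  have := ler_wpM2l t0 (Kx u Ou); have := ler_wpM2l t1' (Ky u Ou); lra.
Qed.

End LpSum.

Theorem theorem3p2 (R : realType) (n : nat) (C A1 A2 : set 'rV[R]_n)
    (p a1 a2 : R) :
  (0 < n)%N ->
  pointed_cone C ->
  coconvex C A1 -> A1 !=set0 ->
  coconvex C A2 -> A2 !=set0 ->
  0 < p < 1 ->
  0 <= a1 -> 0 <= a2 -> ~ (a1 = 0 /\ a2 = 0) ->
  [/\ coconvex C (Lp_sum C p a1 a2 A1 A2),
      Lp_sum C p a1 a2 A1 A2 !=set0 &
      forall x, interior (polar C) x ->
        supp C (Lp_sum C p a1 a2 A1 A2) x =
        (a1 * supp C A1 x `^ p + a2 * supp C A2 x `^ p) `^ p^-1].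
Proof.
move=> n0 coneC cA1 A10 cA2 A20 p01 a10 a20 a120; split.
- exact: coconvex_Lp_sum.
- exact: Lp_sum_nonempty.
- by move=> x ix; exact: supp_Lp_sum.
Qed.
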